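(* For integers $d\ge 1$ and $N\ge 1$, let $H_d(N)$ be the number of tuples $(a_0,a_1,\ldots,a_d)$ of integers with $0\le a_0\le N$, $1\le a_i\le N$ for $i=1,\ldots,d$, and $H(a_0;a_1,\ldots,a_d)\subset\mathcal{S}$. Then $$N\log N\ll H_2(N)\ll N\log N,$$ i.e. there are constants $c_1,c_2>0$ with $c_1N\log N\le H_2(N)\le c_2N\log N$ for all sufficiently large $N$. Furthermore, for every $d$ and every $\varepsilon_d>0$, $$H_d(N)\ll_d N^{1+\varepsilon_d},$$ i.e. there is a constant $C$, depending only on $d$ and $\varepsilon_d$, with $H_d(N)\le C\,N^{1+\varepsilon_d}$ for all $N\ge 1$.
   Context: $\mathcal{S}=\{n^2 : n\in\mathbb{N}\}$ is the set of integer squares ($\mathbb{N}$ contains $0$). The Hilbert cube of dimension $d$ is $H(a_0;a_1,\ldots,a_d)=\{a_0+\sum_{i=1}^d\varepsilon_ia_i : \varepsilon_i\in\{0,1\}\}$. *)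

(* Defs.v *)
From HB Require Import structures.
From mathcomp Require Import all_boot all_order all_algebra.
From mathcomp Require Import all_classical.

Set Implicit Arguments.
Unset Strict Implicit.
Unset Printing Implicit Defensive.

Import Order.TTheory GRing.Theory Num.Theory.
Local Open Scope classical_set_scope.
Local Open Scope ring_scope.

Definition squares : set int := [set n%:Z ^+ 2 | n in [set: nat]].

Definition hilbert_cube (d : nat) (a0 : int) (a : 'I_d -> int) : set int :=
  [set a0 + \sum_(i < d) (eps i : nat)%:Z * a i | eps in [set: 'I_d -> bool]].

(* The integers of [0, N] are the values of the elements of 'I_N.+1, so the
   tuple (a_0, a_1, ..., a_d) is the pair (t.1, t.2), with a_{i+1} = t.2 i for
   i : 'I_d. *)
Definition nb_square_cubes (d N : nat) : nat :=
  #|[set t : 'I_N.+1 * {ffun 'I_d -> 'I_N.+1} |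
      [forall i, 1 <= t.2 i]%N &&
      `[< hilbert_cube (t.1 : nat)%:Z (fun i => (t.2 i : nat)%:Z)
          `<=` squares >] ]%SET|.

(* Main.v *)
Require Import Defs.
From HB Require Import structures.
From Stdlib Require Import PeanoNat.
From mathcomp Require Import all_boot all_order all_algebra cyclic.
From mathcomp Require Import all_classical all_reals all_analysis.
From mathcomp Require Import zify ring lra.

(* In dimension 2 put [x ^ 2 = a0], [y ^ 2 = a0 + a1], [z ^ 2 = a0 + a2],
   [w ^ 2 = a0 + a1 + a2], so that [(w - z) (w + z) = a1 = (y - x) (y + x)].
   With [b] and [c] coprime, such an equality is parametrized by
   [w - z = a b], [w + z = c d], [y - x = a c], [y + x = b d].  The number
   of cubes is at most the number of [(a, b, c, d)] with [a <= d] and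
   [b d, c d <= M := sqrt (12 N)], at most [\sum_d d (M / d) ^ 2], which is of
   order [N log N].  For the lower bound one doubles the four products and takes
   [c = 2 b - e] with [e < b] coprime to [b], together with about [(K / b) ^ 2]
   pairs [(a, d)], where [K = sqrt N]; this produces at least a constant times
   [K ^ 2 \sum_b totient b / b ^ 2], again of order [N log N].  In higher
   dimension there are O(N) pairs [(a0, a1)], and each further [a_i] is
   determined by the divisor [w - z] of [a1], so that the divisor bound
   concludes. *)

Set Implicit Arguments.
Unset Strict Implicit.
Unset Printing Implicit Defensive.

Import Order.TTheory GRing.Theory Num.Theory.
Import numFieldNormedType.Exports.

(** * Counting in the natural numbers *)

Section Counting.
Local Open Scope nat_scope.

(** * Cardinals of finite sets against sizes of sequences *)

Lemma card_le_size (T : finType) (U : eqType) (A : {set T}) (f : T -> U)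
    (s : seq U) :
  {in A &, injective f} -> {in A, forall x, f x \in s} -> #|A| <= size s.
Proof.
move=> finj fs; rewrite cardE -(size_map f); apply: uniq_leq_size.
  rewrite map_inj_in_uniq ?enum_uniq // => x y.
  by rewrite !mem_enum; apply: finj.
by move=> _ /mapP[x xA ->]; apply: fs; rewrite -mem_enum.
Qed.

Lemma size_le_card (T : finType) (U : eqType) (A : {set T}) (g : U -> T)
    (s : seq U) :
  uniq s -> {in s &, injective g} -> {in s, forall u, g u \in A} ->
  size s <= #|A|.
Proof.
move=> us ginj gA; rewrite cardE -(size_map g); apply: uniq_leq_size.
  by rewrite map_inj_in_uniq.
by move=> _ /mapP[u us' ->]; rewrite mem_enum gA.
Qed.

Section Pairs.
Variables (S T : eqType) (s : seq S) (t : S -> seq T).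

Lemma size_pairs_dep :
  size [seq (x, y) | x <- s, y <- t x] = \sum_(x <- s) size (t x).
Proof. by rewrite size_allpairs_dep sumnE big_map. Qed.

Lemma mem_pairs_dep p :
  (p \in [seq (x, y) | x <- s, y <- t x]) = (p.1 \in s) && (p.2 \in t p.1).
Proof.
apply/allpairsPdep/andP => [[x [y [xs yt ->]]] //|[ps pt]].
by exists p.1, p.2; case: p ps pt.
Qed.

Lemma uniq_pairs_dep :
  uniq s -> (forall x, uniq (t x)) -> uniq [seq (x, y) | x <- s, y <- t x].
Proof.
move=> us ut; apply: allpairs_uniq_dep => //.
by move=> [x y] [x' y'] _ _ /= [] -> ->.
Qed.

End Pairs.

(** * Squares and square roots over the natural numbers *)

Definition is_square (n : nat) : bool := Nat.sqrt n ^ 2 == n.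

Lemma sqrt_sqr k : Nat.sqrt (k ^ 2) = k.
Proof. by rewrite -mulnn; apply: Nat.sqrt_square. Qed.

Lemma is_squareP n : reflect (exists k, n = k ^ 2) (is_square n).
Proof.
by apply: (iffP eqP) => [<-|[k ->]]; [exists (Nat.sqrt n)|rewrite sqrt_sqr].
Qed.

Lemma sqrt_le n : Nat.sqrt n ^ 2 <= n.
Proof.
by have [+ _] := Nat.sqrt_spec n (Nat.le_0_l n); rewrite -mulnn => /ssrnat.leP.
Qed.

Lemma sqrt_lt n : n < (Nat.sqrt n).+1 ^ 2.
Proof.
by have [_ +] := Nat.sqrt_spec n (Nat.le_0_l n); rewrite -mulnn => /ssrnat.leP.
Qed.

Lemma sqrt_ge k n : k ^ 2 <= n -> k <= Nat.sqrt n.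
Proof. by move=> kn; rewrite -ltnS -ltn_sqr (leq_ltn_trans kn) ?sqrt_lt. Qed.

(** All entries being natural numbers, the condition descends from integers to the boolean
    [is_square], whose roots [Nat.sqrt] computes. *)
Lemma hilbert_cube_squaresP d (a0 : nat) (a : 'I_d -> nat) :
  (hilbert_cube (Posz a0) (fun i => Posz (a i)) `<=` squares)%classic <->
  forall eps : 'I_d -> bool, is_square (a0 + \sum_(i < d) eps i * a i).
Proof.
have E (eps : 'I_d -> bool) :
  (Posz a0 + \sum_(i < d) Posz (eps i) * Posz (a i) =
   Posz (a0 + \sum_(i < d) eps i * a i)%N)%R.
  by rewrite PoszD (big_morph Posz PoszD erefl).
split=> [sub eps|sq _ [eps _ <-]].
  have [|k _] := sub (Posz (a0 + \sum_(i < d) eps i * a i)).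
    by exists eps => //; rewrite E.
  move=> /eqP; rewrite -rmorphXn /= eqz_nat natrXE => /eqP <-.
  by apply/is_squareP; exists k.
have /is_squareP[k kE] := sq eps.
by exists k => //; rewrite E kE -natrXE.
Qed.

(** The set counted by [nb_square_cubes], named so that membership can be reasoned about; the two
    agree by conversion. *)
Definition square_cubes (d N : nat) :
    {set 'I_N.+1 * {ffun 'I_d -> 'I_N.+1}} :=
  [set t : 'I_N.+1 * {ffun 'I_d -> 'I_N.+1} | [forall i, 1 <= t.2 i] &&
     `[< (hilbert_cube (Posz t.1) (fun i => Posz (t.2 i))
          `<=` squares)%classic >]].

Lemma nb_square_cubesE d N : nb_square_cubes d N = #|square_cubes d N|.
Proof. by []. Qed.

Lemma square_cubesP d N (t : 'I_N.+1 * {ffun 'I_d -> 'I_N.+1}) :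
  reflect ((forall i, 1 <= t.2 i) /\
     forall eps : 'I_d -> bool, is_square (t.1 + \sum_(i < d) eps i * t.2 i))
    (t \in square_cubes d N).
Proof.
rewrite inE; apply: (iffP andP) => [[/forallP pos /asboolP sub]|[pos sq]].
  by split=> //; apply/hilbert_cube_squaresP.
by split; [apply/forallP|apply/asboolP/hilbert_cube_squaresP].
Qed.

Lemma square_cubes2P N (t : 'I_N.+1 * {ffun 'I_2 -> 'I_N.+1}) :
  let a0 := t.1 : nat in let a1 := t.2 ord0 : nat in
  let a2 := t.2 ord_max : nat in
  reflect [/\ 0 < a1, 0 < a2 &
     [/\ is_square a0, is_square (a0 + a1), is_square (a0 + a2) &
         is_square (a0 + a1 + a2)]] (t \in square_cubes 2 N).
Proof.
move=> a0 a1 a2.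
have S (eps : 'I_2 -> bool) :
    t.1 + \sum_(i < 2) eps i * t.2 i = a0 + (eps ord0 * a1 + eps ord_max * a2).
  rewrite big_ord_recl big_ord1.
  congr (_ + (_ + eps _ * t.2 _)); exact: val_inj.
apply: (iffP (square_cubesP t)) => [[pos sq]|[p1 p2 [s0 s1 s2 s3]]].
  have sq' e1 e2 : is_square (a0 + ((e1 : bool) * a1 + (e2 : bool) * a2)).
    by have := sq (fun i => if i == ord0 then e1 else e2); rewrite S.
  split; [exact: pos|exact: pos|split].
  - by have := sq' false false; rewrite !mul0n !addn0.
  - by have := sq' true false; rewrite mul0n mul1n !addn0.
  - by have := sq' false true; rewrite mul0n mul1n.
  - by have := sq' true true; rewrite !mul1n addnA.
split=> [i|eps].
  case: (unliftP ord0 i) => [j|] -> //.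
  by rewrite [j]ord1 (_ : lift _ _ = ord_max) //; apply: val_inj.
by rewrite S; case: (eps _); case: (eps _);
  rewrite ?mul0n ?mul1n ?addn0 ?add0n ?addnA.
Qed.

(** * Dimension 2: the upper bound *)

Lemma cube2_inj N (t t' : 'I_N.+1 * {ffun 'I_2 -> 'I_N.+1}) :
  t.1 = t'.1 :> nat -> t.2 ord0 = t'.2 ord0 :> nat ->
  t.2 ord_max = t'.2 ord_max :> nat -> t = t'.
Proof.
case: t t' => [a f] [a' f'] /= /val_inj -> /val_inj f0 /val_inj f1.
congr pair; apply/ffunP => i.
case: (unliftP ord0 i) => [j|] -> //.
by rewrite [j]ord1 (_ : lift _ _ = ord_max) //; apply: val_inj.
Qed.

Lemma subn_addn_inj x y x' y' : x <= y -> x' <= y' ->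
  y - x = y' - x' -> y + x = y' + x' -> x = x' /\ y = y'.
Proof. lia. Qed.

(** Dividing [p] and [u] by their gcd [a] leaves coprime [b] and [c] with [c * v = b * q]; hence [b]
    divides [v] by Gauss's lemma. *)
Lemma four_factors u v p q : 0 < p -> u * v = p * q ->
  let a := gcdn p u in let b := p %/ a in let c := u %/ a in let d := v %/ b in
  [/\ p = a * b, u = a * c, v = b * d & q = c * d].
Proof.
move=> p0 uv a b c d.
have a0 : 0 < a by rewrite gcdn_gt0 p0.
have pE : p = a * b by rewrite mulnC divnK // dvdn_gcdl.
have uE : u = a * c by rewrite mulnC divnK // dvdn_gcdr.
have b0 : 0 < b by move: p0; rewrite pE muln_gt0 => /andP[].
have cop : coprime b c.
  by rewrite /coprime -(eqn_pmul2l a0) muln_gcdr -pE -uE muln1.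
have bcq : c * v = b * q.
  by apply/eqP; rewrite -(eqn_pmul2l a0) !mulnA -uE -pE uv.
have vE : v = b * d.
  rewrite mulnC divnK // -(Gauss_dvdr _ cop); apply/dvdnP; exists q.
  by rewrite bcq mulnC.
split=> //; apply/eqP; rewrite -(eqn_pmul2l b0) -bcq {1}vE; apply/eqP; ring.
Qed.

Lemma nb_square_cubes2_le N :
  nb_square_cubes 2 N <=
    \sum_(1 <= d < (Nat.sqrt (12 * N)).+1) d * (Nat.sqrt (12 * N) %/ d) ^ 2.
Proof.
set M := Nat.sqrt _.
(* The largest factor [d] comes first because it alone bounds the ranges of [a], [b] and [c]. *)
pose quads := [seq (d, p) | d <- index_iota 1 M.+1,
  p <- [seq (a, q) | a <- index_iota 1 d.+1,
    q <- [seq (b, c) | b <- index_iota 1 (M %/ d).+1,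
                       c <- index_iota 1 (M %/ d).+1]]].
have -> : \sum_(1 <= d < M.+1) d * (M %/ d) ^ 2 = size quads.
  rewrite size_pairs_dep; apply: eq_bigr => d _.
  rewrite size_pairs_dep sum_nat_const_nat subn1 size_pairs_dep.
  by rewrite sum_nat_const_nat subn1 size_iota subn1 /= mulnn.
pose rt (t : 'I_N.+1 * {ffun 'I_2 -> 'I_N.+1}) :=
  (Nat.sqrt t.1, Nat.sqrt (t.1 + t.2 ord0), Nat.sqrt (t.1 + t.2 ord_max),
   Nat.sqrt (t.1 + t.2 ord0 + t.2 ord_max)).
pose quad t := let: (x, y, z, w) := rt t in
  let a := gcdn (w - z) (y - x) in let b := (w - z) %/ a in
  let c := (y - x) %/ a in let d := (y + x) %/ b in (d, (a, (b, c))).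
have key t : t \in square_cubes 2 N -> let: (x, y, z, w) := rt t in
  let: (d, (a, (b, c))) := quad t in
  [/\ t.1 = x ^ 2 :> nat, t.1 + t.2 ord0 = y ^ 2, t.1 + t.2 ord_max = z ^ 2,
      t.1 + t.2 ord0 + t.2 ord_max = w ^ 2 &
  [/\ w - z = a * b, y - x = a * c, y + x = b * d, w + z = c * d &
     x < y /\ z < w]].
  move=> /square_cubes2P /= [p1 p2 [/eqP s0 /eqP s1 /eqP s2 /eqP s3]].
  rewrite /quad /rt /=.
  set x := Nat.sqrt _ in s0 *; set y := Nat.sqrt _ in s1 *.
  set z := Nat.sqrt _ in s2 *; set w := Nat.sqrt _ in s3 *.
  have xy : x < y by rewrite -ltn_sqr s0 s1; lia.
  have zw : z < w by rewrite -ltn_sqr s2 s3; lia.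
  split=> //.
  case: (@four_factors (y - x) (y + x) (w - z) (w + z)) => //.
  - lia.
  - by rewrite -!subn_sqr s0 s1 s2 s3; lia.
(* Injectivity: the four products give the sums and differences of the roots, hence the roots and
   the cube. *)
apply: (card_le_size (f := quad)).
  move=> t t' /key + /key +.
  case: (rt t) (quad t) => [[[x y] z] w] [d [a [b c]]].
  case: (rt t') (quad t') => [[[x' y'] z'] w'] [d' [a' [b' c']]].
  move=> [s0 s1 s2 s3 [e1 e2 e3 e4 [xy zw]]].
  move=> [s0' s1' s2' s3' [e1' e2' e3' e4' [xy' zw']]].
  move=> [? ? ? ?]; subst d' a' b' c'.
  have [||||? ?] := @subn_addn_inj x y x' y'; try exact: ltnW.
  - by rewrite e2 e2'.
  - by rewrite e3 e3'.
  have [||||? _] := @subn_addn_inj z w z' w'; try exact: ltnW.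
  - by rewrite e1 e1'.
  - by rewrite e4 e4'.
  subst x' y' z'.
  have t1E : t.1 = t'.1 :> nat by rewrite s0.
  apply: cube2_inj => //; apply: (@addnI t.1); first by rewrite s1 t1E.
  by rewrite s2 t1E.
move=> t /key.
have t1N := ltn_ord t.1.
have t20N := ltn_ord (t.2 ord0).
have t21N := ltn_ord (t.2 ord_max).
case: (rt t) (quad t) => [[[x y] z] w] [d [a [b c]]].
move=> [s0 s1 s2 s3 [e1 e2 e3 e4 [xy zw]]].
have [b0 a0] : 0 < b /\ 0 < a by
  split; rewrite lt0n; apply/eqP => E; rewrite E in e1 e2; lia.
have c0 : 0 < c by rewrite lt0n; apply/eqP => E; rewrite E in e2; lia.
have d0 : 0 < d by rewrite lt0n; apply/eqP => E; rewrite E in e3; lia.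
have bdM : b * d <= M.
  apply: sqrt_ge; rewrite -e3; apply: (@leq_trans ((2 * y) ^ 2)).
    by rewrite leq_sqr; lia.
  by rewrite expnMn -s1; lia.
(* The constant 12 comes from here: [c * d = w + z <= 2 * w] and [w ^ 2 <= 3 * N]. *)
have cdM : c * d <= M.
  apply: sqrt_ge; rewrite -e4; apply: (@leq_trans ((2 * w) ^ 2)).
    by rewrite leq_sqr; lia.
  by rewrite expnMn -s3; lia.
have dM : d <= M by apply: leq_trans bdM; rewrite leq_pmull.
(* Multiply [w - z <= w + z] by [y - x <= y + x] and cancel [b * c]. *)
have ad : a <= d.
  have ab : a * b <= c * d by lia.
  have ac : a * c <= b * d by lia.
  have := leq_mul ab ac.
  rewrite mulnACA [c * d * _]mulnACA (mulnC c b) (mulnC (a * a)) leq_pmul2l.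
    by rewrite !mulnn leq_sqr.
  by rewrite muln_gt0 b0.
by rewrite !mem_pairs_dep /= !mem_index_iota !ltnS !leq_divRL //
  a0 b0 c0 d0 ad bdM cdM dM.
Qed.

(** * Dimension 2: the lower bound from an explicit family *)

Lemma sqr_addn_subn m n : n <= m -> (m + n) ^ 2 = (m - n) ^ 2 + 4 * (m * n).
Proof.
by move=> /subnKC <-; rewrite addKn; ring.
Qed.

(** Coprimality of [b] and [c] makes [a] the gcd of [a * b] and [a * c]; the other factors follow by
    cancellation. *)
Lemma factors_inj a b c d a' b' c' d' :
  0 < a -> 0 < b -> coprime b c -> coprime b' c' ->
  a * b = a' * b' -> a * c = a' * c' -> b * d = b' * d' ->
  [/\ a = a', b = b', c = c' & d = d'].
Proof.
move=> a0 b0 /eqP cop /eqP cop' ab ac bd.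
have aE : a = a'.
  by rewrite -[a]muln1 -cop muln_gcdr ab ac -muln_gcdr cop' muln1.
move: ab ac; rewrite -aE => /eqP; rewrite eqn_pmul2l // => /eqP bE /eqP.
rewrite eqn_pmul2l // => /eqP cE; split=> //.
by move: bd; rewrite -bE => /eqP; rewrite eqn_pmul2l // => /eqP.
Qed.

Lemma muln_subn_subn (b c a d : nat) : b <= c -> a <= d ->
  (c - b) * (d - a) + b * d + a * c = c * d + a * b.
Proof. by move=> /subnKC <- /subnKC <-; rewrite !addKn; ring. Qed.

(** Both squares have the same cross term in [a * b * c * d], so their difference factors. This
    factored form is the entry [a2] of the family. *)
Lemma square_cube_identity a b c d : a <= d -> b <= c -> a * c <= b * d ->
  (b * d - a * c) ^ 2 + (c ^ 2 - b ^ 2) * (d ^ 2 - a ^ 2) = (c * d - a * b) ^ 2.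
Proof.
move=> ad bc acbd; have abcd : a * b <= c * d by rewrite mulnC leq_mul.
have := sqr_addn_subn acbd; have := sqr_addn_subn abcd; rewrite !sqrnD !expnMn.
have := @muln_subn_subn (b ^ 2) (c ^ 2) (a ^ 2) (d ^ 2); rewrite !leq_sqr.
move=> /(_ bc ad).
have -> : b * d * (a * c) = a * b * c * d by ring.
have -> : c * d * (a * b) = a * b * c * d by ring.
lia.
Qed.

Lemma sum_totient_le_nb_square_cubes2 N :
  \sum_(1 <= b < (Nat.sqrt N).+1) totient b * (Nat.sqrt N %/ (6 * b)) ^ 2 <=
    nb_square_cubes 2 N.
Proof.
set K := Nat.sqrt N.
pose quads := [seq (b, p) | b <- index_iota 1 K.+1,
  p <- [seq (e, q) | e <- [seq e <- index_iota 0 b | coprime b e],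
    q <- [seq (a, j) | a <- index_iota 1 (K %/ (6 * b)).+1,
                       j <- index_iota 1 (K %/ (6 * b)).+1]]].
have -> : \sum_(1 <= b < K.+1) totient b * (K %/ (6 * b)) ^ 2 = size quads.
  rewrite size_pairs_dep; apply: eq_bigr => b _.
  rewrite size_pairs_dep big_filter totient_count_coprime big_distrl.
  rewrite [RHS]big_mkcond; apply: eq_bigr => e _; rewrite size_pairs_dep.
  rewrite sum_nat_const_nat subn1 size_iota subn1 /= mulnn.
  by case: coprime; rewrite ?mul1n.
(* With [D = K %/ (6 * b)], the choice gives [b < c <= 2 * b], [a <= D] and [2 * D < d <= 3 * D].
   Thus [a * c <= 2 * a * b <= b * d], and no root is a truncated difference. *)
pose abcd (p : nat * (nat * (nat * nat))) :=
  let: (b, (e, (a, j))) := p in (a, b, 2 * b - e, 2 * (K %/ (6 * b)) + j).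
pose cube p : 'I_N.+1 * {ffun 'I_2 -> 'I_N.+1} :=
  let: (a, b, c, d) := abcd p in
  (inord ((b * d - a * c) ^ 2),
   [ffun i => if i == ord0 then inord (4 * (a * b * c * d))
              else inord ((c ^ 2 - b ^ 2) * (d ^ 2 - a ^ 2))]).
(* The family below has [x = b d - a c], [y = b d + a c], [z = c d - a b],
   [w = c d + a b]. *)
have key p : p \in quads -> let: (a, b, c, d) := abcd p in
  [/\ [/\ 0 < a, 0 < b, a < d, b < c & a * c <= b * d], coprime b c &
   [/\ (cube p).1 = (b * d - a * c) ^ 2 :> nat,
       (cube p).1 + (cube p).2 ord0 = (b * d + a * c) ^ 2,
       (cube p).1 + (cube p).2 ord_max = (c * d - a * b) ^ 2,
       (cube p).1 + (cube p).2 ord0 + (cube p).2 ord_max = (c * d + a * b) ^ 2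
     & 0 < (cube p).2 ord0 /\ 0 < (cube p).2 ord_max]].
  case: p => b [e [a j]].
  rewrite !mem_pairs_dep /= mem_filter !mem_index_iota /=.
  rewrite !ltnS; set D := K %/ _; set c := 2 * b - e; set d := 2 * D + j.
  move=> /and4P[/andP[b0 bK] /andP[cop eb] /andP[a0 aD] /andP[j0 jD]].
  have ad2 : 2 * a <= d by lia.
  have ad : a < d by lia.
  have bc : b < c by lia.
  have [c0 d0] : 0 < c /\ 0 < d by lia.
  have c2b : c <= 2 * b by lia.
  have acbd : a * c <= b * d.
    apply: (@leq_trans (a * (2 * b))); first by rewrite leq_mul2l c2b orbT.
    by rewrite mulnA (mulnC a) mulnC leq_mul2l ad2 orbT.
  have copbc : coprime b c.
    have ce : c + e = 2 * b by rewrite subnK //; lia.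
    rewrite /coprime -dvdn1 -(eqP cop) dvdn_gcd dvdn_gcdl.
    by rewrite -(dvdn_addr e (dvdn_gcdr b c)) ce dvdn_mull ?dvdn_gcdl.
  (* Here the 6 matters: [2 * b * d <= 6 * b * D <= K]. The next three bounds reduce to this one and
     make every [inord] in [cube] exact. *)
  have VN : (2 * (b * d)) ^ 2 <= N.
    apply: leq_trans (sqrt_le N); rewrite leq_sqr -/K.
    apply: leq_trans (leq_divM K (6 * b)); rewrite -/D.
    have -> : D * (6 * b) = 2 * (b * (3 * D)) by ring.
    by rewrite !leq_mul2l; apply/orP; right; apply/orP; right; lia.
  have A0 : (b * d - a * c) ^ 2 <= N.
    by apply: leq_trans VN; rewrite leq_sqr; lia.
  have A1 : 4 * (a * b * c * d) <= N.
    apply: leq_trans VN.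
    have -> : (2 * (b * d)) ^ 2 = 2 * d * (b * (2 * b) * d) by ring.
    have -> : 4 * (a * b * c * d) = 2 * (2 * a) * (b * c * d) by ring.
    by rewrite leq_mul ?leq_mul.
  have A2 : (c ^ 2 - b ^ 2) * (d ^ 2 - a ^ 2) <= N.
    apply: leq_trans VN.
    have -> : (2 * (b * d)) ^ 2 = (2 * b) ^ 2 * d ^ 2 by ring.
    by rewrite leq_mul ?(leq_trans (leq_subr _ _)) ?leq_sqr.
  have abcd_le : a * b <= c * d by rewrite mulnC leq_mul // ltnW.
  have I1 := sqr_addn_subn acbd; have I2 := sqr_addn_subn abcd_le.
  have E1 : b * d * (a * c) = a * b * c * d by ring.
  have E2 : c * d * (a * b) = a * b * c * d by ring.
  have I3 := square_cube_identity (ltnW ad) (ltnW bc) acbd.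
  split=> //; rewrite /cube /= !ffunE /= !inordK //; split=> //.
  + by rewrite I1 E1.
  + by rewrite I2 E2 -I3 addnAC.
  by rewrite !muln_gt0 a0 b0 c0 d0 !subn_gt0 !ltn_sqr bc ad.
apply: (size_le_card (g := cube)).
- apply: uniq_pairs_dep => [|b]; first exact: iota_uniq.
  apply: uniq_pairs_dep => [|e]; first by rewrite filter_uniq ?iota_uniq.
  by apply: uniq_pairs_dep => [|a]; exact: iota_uniq.
- move=> p p' pq p'q E; move: (key _ pq) (key _ p'q).
  rewrite -E; move: (cube p) => t {E}.
  case: p p' pq p'q => [b [e [a j]]] [b' [e' [a' j']]].
  rewrite !mem_pairs_dep /= !mem_filter !mem_index_iota /=.
  move=> /and4P[_ /andP[_ eb] _ _] /and4P[_ /andP[_ eb'] _ _].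
  set c := 2 * b - e; set d := _ + j; set c' := 2 * b' - e'; set d' := _ + j'.
  move=> [[a0 b0 ad bc acbd] cop [s0 s1 s2 s3 _]].
  move=> [[a0' b0' ad' bc' acbd'] cop' [s0' s1' s2' s3' _]].
  (* The roots [x], [y] determine [a * c] and [b * d]; below, [z] and [w] determine [a * b] and
     [c * d]. *)
  have [F1 F2] := subn_addn_inj acbd acbd'
    (sqrn_inj (etrans (esym s0) s0')) (sqrn_inj (etrans (esym s1) s1')).
  have abcd_le : a * b <= c * d by rewrite mulnC leq_mul // ltnW.
  have abcd_le' : a' * b' <= c' * d' by rewrite mulnC leq_mul // ltnW.
  have [F3 F4] := subn_addn_inj abcd_le abcd_le'
    (sqrn_inj (etrans (esym s2) s2')) (sqrn_inj (etrans (esym s3) s3')).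
  have [aE bE cE dE] := factors_inj a0 b0 cop cop' F3 F1 F2.
  move: cE dE; rewrite /c /d /c' /d' -bE -aE => cE /addnI ->.
  suff -> : e = e' by [].
  by move: cE eb eb'; rewrite -bE; clear; lia.
move=> p /key; case: (abcd p) => [[[a b] c] d] [_ _ [s0 s1 s2 s3 [p1 p2]]].
apply/square_cubes2P; split=> //; rewrite s3 s2 s1 s0.
by split; apply/is_squareP; eexists.
Qed.

(** * Arbitrary dimension: fibres over the pair [(a0, a1)] *)

Lemma square_cubes_edge d N (t : 'I_N.+1 * {ffun 'I_d -> 'I_N.+1}) i :
  t \in square_cubes d N -> is_square t.1 /\ is_square (t.1 + t.2 i).
Proof.
move=> /square_cubesP[_ sq]; split.
  by have := sq (fun=> false); rewrite big1 ?addn0.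
have := sq (pred1 i); rewrite (bigD1 i) //= eqxx big1 ?addn0 ?mul1n //.
by move=> j /negPf->.
Qed.

Lemma square_cubes_face d N (t : 'I_N.+1 * {ffun 'I_d -> 'I_N.+1}) i j :
  t \in square_cubes d N -> j != i -> is_square (t.1 + t.2 i + t.2 j).
Proof.
move=> /square_cubesP[_ sq] ji; have := sq (pred2 i j).
rewrite (bigD1 i) //= eqxx (bigD1 j) //= eqxx orbT big1 ?addn0 ?mul1n ?addnA //.
by move=> k /andP[/negPf-> /negPf->].
Qed.

(** The difference of the two roots divides [n]. As [n] is positive, it determines their sum by
    division, hence the roots and [a]. *)
Lemma card_square_shifts N (m n : nat) : 0 < n ->
  #|[set a : 'I_N.+1 | is_square (m + a) && is_square (m + n + a)]| <=
    size (divisors n).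
Proof.
move=> n0.
pose gap (a : 'I_N.+1) := Nat.sqrt (m + n + a) - Nat.sqrt (m + a).
have key (a : 'I_N.+1) : is_square (m + a) && is_square (m + n + a) ->
  [/\ Nat.sqrt (m + a) <= Nat.sqrt (m + n + a), Nat.sqrt (m + a) ^ 2 = m + a &
      gap a * (Nat.sqrt (m + n + a) + Nat.sqrt (m + a)) = n].
  move=> /andP[/eqP s /eqP s']; rewrite /gap -subn_sqr s s' -leq_sqr s s'.
  by split=> //; lia.
apply: (card_le_size (f := gap)).
  move=> a b; rewrite !inE => /key[la sa ea] /key[lb sb eb] gab.
  apply: val_inj; have g0 : 0 < gap a by case: (gap a) ea n0 => // <-.
  have := etrans ea (esym eb); rewrite -gab => /eqP.
  rewrite eqn_pmul2l // => /eqP sab.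
  have [E _] := subn_addn_inj la lb gab sab.
  by apply: (@addnI m); rewrite -sa -sb E.
move=> a; rewrite inE => /key[_ _ ga]; rewrite -dvdn_divisors //.
by apply/dvdnP; eexists; rewrite mulnC; exact/esym/ga.
Qed.

(** A pair is determined by two roots in [[0, K]], and [K.+1 ^ 2 <= 4 * K ^ 2 <= 8 * N] since [K] is
    positive. *)
Lemma card_square_pairs N : 0 < N ->
  #|[set p : 'I_N.+1 * 'I_N.+1 | is_square p.1 && is_square (p.1 + p.2)]| <=
    8 * N.
Proof.
move=> N0; set K := Nat.sqrt (2 * N).
apply: (@leq_trans (K.+1 * K.+1)); last first.
  have K0 : 0 < K by apply: sqrt_ge; lia.
  have K2 : K * K <= 2 * N by rewrite mulnn sqrt_le.
  nia.
pose rt (p : 'I_N.+1 * 'I_N.+1) := (Nat.sqrt p.1, Nat.sqrt (p.1 + p.2)).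
rewrite -{1 2}[K.+1](size_iota 0) -(size_allpairs pair).
apply: (card_le_size (f := rt)).
  move=> [a b] [a' b']; rewrite !inE /= => /andP[/eqP s1 /eqP s2].
  move=> /andP[/eqP s1' /eqP s2'] [e1 e2].
  have aa : a = a' by apply: val_inj; rewrite /= -s1 -s1' e1.
  congr pair => //; apply: val_inj; apply: (@addnI a).
  by rewrite /= -s2 e2 s2' aa.
move=> p; rewrite inE => /andP[/eqP s1 /eqP s2].
have pN i : i <= N -> i <= 2 * N by lia.
apply/allpairsPdep; exists (Nat.sqrt p.1), (Nat.sqrt (p.1 + p.2)).
split=> //; rewrite mem_iota add0n ltnS; apply: sqrt_ge; rewrite ?s1 ?s2.
  by apply: pN; rewrite -ltnS.
by rewrite mul2n -addnn leq_add // -ltnS.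
Qed.

Lemma nb_square_cubes_le d N T : 0 < d -> 0 < N ->
  (forall n, 0 < n <= N -> size (divisors n) <= T) ->
  nb_square_cubes d N <= 8 * N * T.+1 ^ d.
Proof.
case: d => // d _ N0 divT; rewrite nb_square_cubesE.
pose P := [set p : 'I_N.+1 * 'I_N.+1 | is_square p.1 && is_square (p.1 + p.2)].
(* Adjoining [p.2] lets the first side lie in the same set as the others, so that a fibre embeds in
   the functions into [S p]. This explains [T.+1]. *)
pose S (p : 'I_N.+1 * 'I_N.+1) := p.2 |:
  [set a : 'I_N.+1 | is_square (p.1 + a) && is_square (p.1 + p.2 + a)].
pose h (t : 'I_N.+1 * {ffun 'I_d.+1 -> 'I_N.+1}) := (t.1, t.2 ord0).
have hP t : t \in square_cubes d.+1 N -> h t \in P.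
  by move=> /(square_cubes_edge ord0)[s1 s2]; rewrite inE s1 s2.
rewrite -sum1_card (partition_big h (mem P)) //=.
apply: (@leq_trans (\sum_(p in P) T.+1 ^ d.+1)); last first.
  by rewrite sum_nat_const leq_mul2r card_square_pairs ?orbT.
apply: leq_sum => p pP; rewrite sum1_card.
pose F := [set t in square_cubes d.+1 N | h t == p].
have -> : #|[pred t | (t \in square_cubes d.+1 N) && (h t == p)]| = #|F|.
  by rewrite cardsE.
have [->|[t0]] := set_0Vmem F; first by rewrite cards0.
rewrite inE => /andP[/square_cubesP[pos _] /eqP hp].
have p20 : 0 < p.2 by rewrite -hp; apply: pos.
apply: (@leq_trans (#|S p| ^ d.+1)); last first.
  rewrite leq_exp2r // cardsU1 -[T.+1]add1n.
  apply: leq_add; first by case: (_ \notin _).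
  apply: leq_trans (divT p.2 _); first exact: card_square_shifts.
  by rewrite p20 -ltnS ltn_ord.
have -> : #|S p| ^ d.+1 = #|@ffun_on 'I_d.+1 (S p)|.
  by rewrite card_ffun_on card_ord.
have inj : {in F &, injective (fun t => t.2)}.
  move=> [a f] [b g]; rewrite !inE => /andP[_ /eqP hf] /andP[_ /eqP hg] /= fg.
  by move: hf hg => /(congr1 fst) /= -> /(congr1 fst) /= ->; rewrite fg.
rewrite -(card_in_imset inj); apply/subset_leq_card/fintype.subsetP.
move=> _ /imsetP[t + ->]; rewrite inE => /andP[tA /eqP ht].
apply/ffun_onP => i; rewrite -ht !inE /=.
have [->|i0] := eqVneq i ord0; first by rewrite eqxx.
have [_ ->] := square_cubes_edge i tA.
by rewrite (square_cubes_face tA i0) orbT.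
Qed.

End Counting.

Local Open Scope classical_set_scope.
Local Open Scope ring_scope.

(** * Harmonic sums, totients and divisors *)

Section Harmonic.
Variable R : realType.

(** Sum the inequality [ln (1 + x) <= x] at [x = 1 / k]. *)
Lemma ln_le_harmonic n : ln n.+1%:R <= \sum_(1 <= k < n.+1) k%:R^-1 :> R.
Proof.
elim: n => [|n IHn]; first by rewrite ln1 big_geq.
rewrite big_nat_recr //=; apply: le_trans (lerD IHn (le_ln1Dx _)); last first.
  by rewrite (lt_le_trans (ltrN10 _)) // invr_ge0.
have n0 : n.+1%:R != 0 :> R by rewrite pnatr_eq0.
rewrite -lnM ?posrE ?ltr0n ?addr_gt0 ?invr_gt0 ?ltr0n //.
by rewrite mulrDr mulr1 divff // natr1.
Qed.

(** Here the same inequality is used at [x = - 1 / k], for [k] at least 2. *)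
Lemma harmonic_le_ln n : (0 < n)%N ->
  \sum_(1 <= k < n.+1) k%:R^-1 <= 1 + ln n%:R :> R.
Proof.
elim: n => // -[_ _|n IHn _]; first by rewrite big_nat1 ln1 addr0 invr1.
rewrite big_nat_recr //=; apply: le_trans (lerD (IHn isT) (lexx _)) _.
rewrite -addrA lerD2l.
have n0 : n.+2%:R != 0 :> R by rewrite pnatr_eq0.
have E : n.+1%:R / n.+2%:R = 1 + - n.+2%:R^-1 :> R.
  by rewrite -{1}[n.+2%:R](@natr1 R n.+1) in n0 *; field.
have := @le_ln1Dx R (- n.+2%:R^-1); rewrite -E ln_div ?posrE ?ltr0n // => le.
have : ln n.+1%:R - ln n.+2%:R <= - n.+2%:R^-1 :> R.
  by apply: le; rewrite ltrN2 invf_lt1 ?ltr0n ?ltr1n.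
rewrite -subr_ge0 => le'; rewrite -subr_ge0 (le_trans le') // le_eqVlt.
by apply/orP; left; apply/eqP; ring.
Qed.

Lemma sum_invr_sqr_le2 n : \sum_(1 <= k < n.+1) (k%:R ^+ 2)^-1 <= 2 :> R.
Proof.
case: n => [|n]; first by rewrite big_geq.
(* The strengthened bound telescopes: [1 / x - 1 / (x + 1) - 1 / (x + 1) ^ 2 = 1 / (x * (x + 1) ^
   2)]. *)
suff : \sum_(1 <= k < n.+2) (k%:R ^+ 2)^-1 <= 2 - n.+1%:R^-1 :> R.
  by move=> /le_trans; apply; rewrite gerBl invr_ge0.
elim: n => [|n IHn]; first by rewrite big_nat1; lra.
rewrite big_nat_recr //=; apply: le_trans (lerD IHn (lexx _)) _.
have n0 : 0 < n.+1%:R :> R by rewrite ltr0n.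
rewrite -[n.+2%:R](@natr1 R n.+1); move: (n.+1%:R : R) n0 => x x0.
rewrite -subr_ge0 (_ : _ - _ = (x * (x + 1) ^+ 2)^-1).
  by rewrite invr_ge0 mulr_ge0 ?sqr_ge0 // ltW.
by field; lra.
Qed.

Lemma sum_multiples (V : nmodType) (F : nat -> V) d n : (0 < d)%N ->
  \sum_(1 <= c < n.+1 | (d %| c)%N) F c =
  \sum_(1 <= m < (n %/ d).+1) F (d * m)%N.
Proof.
move=> d0; elim: n => [|n IHn]; first by rewrite div0n !big_geq.
rewrite big_mkcond big_nat_recr //= -big_mkcond IHn divnS //.
case: ifP => dn; last by rewrite addr0.
rewrite add1n [RHS]big_nat_recr //=; congr (_ + F _).
by have := divnS n d0; rewrite dn add1n => <-; rewrite mulnC divnK.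
Qed.

(** Gauss's totient identity over a range independent of [c], ready for an exchange of
    summations. *)
Lemma sum_totient_dvd_nat c n : (0 < c <= n)%N ->
  (\sum_(1 <= d < n.+1 | d %| c) totient d = c)%N.
Proof.
move=> /andP[c0 cn]; rewrite -{2}(sum_totient_dvd c).
rewrite -(big_mkord (fun d => d %| c)%N) [RHS]big_ltn_cond // dvd0n.
rewrite (gtn_eqF c0) (@big_cat_nat _ _ _ c.+1) //=.
rewrite [X in (_ + X)%N]big_nat_cond [X in (_ + X)%N]big_pred0 ?addn0 //.
move=> d; apply/negbTE/negP => /andP[/andP[cd _] /dvdn_leq]; lia.
Qed.

(* Insert [c = \sum_(d %| c) totient d] into [\sum_c c / c ^ 2] and write
   [c = d * m]: the sum over [m] is at most [\sum_m m ^- 2 <= 2]. *)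
Lemma harmonic_le_totient n :
  \sum_(1 <= c < n.+1) c%:R^-1 <=
    2 * \sum_(1 <= d < n.+1) (totient d)%:R / d%:R ^+ 2 :> R.
Proof.
have -> : \sum_(1 <= c < n.+1) c%:R^-1 =
    \sum_(1 <= c < n.+1) \sum_(1 <= d < n.+1 | (d %| c)%N)
      (totient d)%:R / c%:R ^+ 2 :> R.
  apply: eq_big_nat => c /andP[c0 cn].
  rewrite -mulr_suml -natr_sum sum_totient_dvd_nat ?c0 //.
  have : c%:R != 0 :> R by rewrite pnatr_eq0 -lt0n.
  by move=> ?; field.
rewrite (exchange_big_dep xpredT) //= mulr_sumr.
apply: ler_sum_nat => d /andP[d0 dn].
rewrite (sum_multiples (fun c => (totient d)%:R / c%:R ^+ 2)) //.
under eq_bigr do rewrite natrM exprMn invfM mulrA.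
rewrite -mulr_sumr mulrC ler_wpM2r //.
exact: sum_invr_sqr_le2.
Qed.

End Harmonic.

(** * Growth of the number of divisors *)

Lemma size_divisorsM m n : (0 < m)%N -> (0 < n)%N ->
  (size (divisors (m * n)) <= size (divisors m) * size (divisors n))%N.
Proof.
move=> m0 n0; rewrite -(size_allpairs muln).
apply: uniq_leq_size => [|d]; first exact: divisors_uniq.
rewrite -dvdn_divisors ?muln_gt0 ?m0 // => dmn.
have g0 : (0 < gcdn d m)%N by rewrite gcdn_gt0 m0 orbT.
(* Split [d] as [gcdn d m] times a cofactor; the cofactor is coprime to [m %/ gcdn d m], so it
   divides [n]. *)
apply/allpairsPdep; exists (gcdn d m), (d %/ gcdn d m)%N.
rewrite -!dvdn_divisors // dvdn_gcdr mulnC divnK ?dvdn_gcdl //; split=> //.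
have cop : coprime (d %/ gcdn d m) (m %/ gcdn d m).
  by rewrite /coprime -(eqn_pmul2r g0) muln_gcdl !divnK ?dvdn_gcdl ?dvdn_gcdr //
    mul1n.
rewrite -(Gauss_dvdr _ cop) -(dvdn_pmul2r g0) divnK ?dvdn_gcdl //.
by rewrite mulnAC divnK ?dvdn_gcdr.
Qed.

Lemma size_divisorsX p e : prime p -> (size (divisors (p ^ e)) <= e.+1)%N.
Proof.
move=> pp; rewrite -[e.+1](size_iota 0) -(size_map (expn p) (iota _ _)).
apply: uniq_leq_size => [|d]; first exact: divisors_uniq.
rewrite -dvdn_divisors ?expn_gt0 ?prime_gt0 //.
move=> /(dvdn_pfactor _ _ pp)[k ke ->].
by rewrite map_f // mem_iota.
Qed.

Section DivisorBound.
Variable R : realType.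

Lemma prime_power_bound (eps : R) : 0 < eps ->
  exists C (P : nat), 1 <= C /\ forall p e : nat, prime p ->
    e.+1%:R <= (if (p < P)%N then C else 1) * (p ^ e)%:R `^ eps.
Proof.
move=> eps0; have ln2 : 0 < ln 2 :> R by rewrite ln_gt0 ?ltr1n.
have d0 : 0 < eps * ln 2 by rewrite mulr_gt0.
(* The threshold exceeds [2]^ eps^-1[, so that larger primes satisfy]p [^ eps >= 2]. The constant
   serves smaller primes: it makes [C * (1 + e * (eps * ln 2))] at least [1 + e]. *)
exists (1 + (eps * ln 2)^-1), (Num.truncn (2 `^ eps^-1 : R)).+1.
split=> [|p e pp]; first by rewrite lerDl invr_ge0 ltW.
have p0 : 0 < p%:R :> R by rewrite ltr0n prime_gt0.
have -> : (p ^ e)%:R `^ eps = (p%:R `^ eps) ^+ e :> R.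
  rewrite natrX -powR_mulrn ?ler0n // -powRrM mulrC powRrM.
  by rewrite powR_mulrn ?powR_ge0.
(* Large primes satisfy [p `^ eps >= 2], and [2 ^ e >= e + 1]. *)
case: ltnP => pP.
  (* Convexity, [1 + x <= expR x], together with [ln 2 <= ln p]. *)
  have le1 : 1 + e%:R * (eps * ln 2) <= (p%:R `^ eps) ^+ e.
    rewrite /powR gt_eqF // -expRM_natl (le_trans (expR_ge1Dx _)) // ler_expR.
    rewrite ler_wpM2l // ler_wpM2l ?(ltW eps0) // ler_ln ?posrE //.
    by rewrite ler_nat prime_gt1.
  apply: le_trans (ler_wpM2l _ le1); last first.
    by rewrite addr_ge0 // invr_ge0 ltW.
  move: (eps * ln 2) d0 => d d0.
  have -> : (1 + d^-1) * (1 + e%:R * d) = (1 + e%:R) + (d^-1 + e%:R * d).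
    by field; rewrite gt_eqF.
  rewrite -natr1 addrC lerDl addr_ge0 ?mulr_ge0 ?invr_ge0 ?(ltW d0) //.
rewrite mul1r; apply: (@le_trans _ _ (2 ^+ e)).
  by rewrite -natrX ler_nat ltn_expl.
rewrite lerXn2r ?nnegrE ?powR_ge0 //.
have -> : 2 = (2 `^ eps^-1) `^ eps :> R.
  by rewrite -powRrM mulVf ?gt_eqF // powRr1.
rewrite ge0_ler_powR ?nnegrE ?powR_ge0 ?(ltW eps0) ?(ltW p0) //.
rewrite (le_trans (ltW (truncnS_gt _))) //.
by rewrite ler_nat.
Qed.

(* Induction on the bound [P] of the prime factors: peeling off the [P]-part of
   [n] costs a factor [C] only when [P < P0]. *)
Lemma divisor_bound (eps : R) : 0 < eps ->
  exists C : R, forall n, (0 < n)%N ->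
    (size (divisors n))%:R <= C * n%:R `^ eps.
Proof.
move=> /prime_power_bound[C [P0 [C1 bound]]].
(* The exponent counts all integers below both [P] and [P0], prime or not, so it never exceeds
   [P0]. *)
suff H P n : (0 < n)%N -> (forall p, prime p -> (p %| n)%N -> (p < P)%N) ->
    (size (divisors n))%:R <= C ^+ minn P P0 * n%:R `^ eps.
  exists (C ^+ P0) => n n0; apply: le_trans (H n.+1 n n0 _) _.
    by move=> p _ /dvdn_leq; rewrite ltnS; apply.
  by rewrite ler_wpM2r ?powR_ge0 // ler_weXn2l // geq_minr.
elim: P n => [|P IH] n n0 smooth.
  suff -> : n = 1%N by rewrite min0n expr0 mul1r powR1.
  apply/eqP; rewrite eqn_leq n0 andbT leqNgt; apply/negP => n1.
  by have := smooth _ (pdiv_prime n1) (pdiv_dvd n).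
have CP : C ^+ minn P P0 <= C ^+ minn P.+1 P0.
  by rewrite ler_weXn2l // leq_min !geq_min leqnSn leqnn orbT.
case: (boolP (prime P)) => [pP|npP]; last first.
  apply: le_trans (IH n n0 _) (ler_wpM2r (powR_ge0 _ _) CP).
  move=> p pp pn; have := smooth p pp pn; rewrite ltnS leq_eqVlt.
  by case/predU1P => // pE; rewrite -pE pp in npP.
have [m Pm nE] := pfactor_coprime pP n0.
have m0 : (0 < m)%N by move: n0; rewrite nE muln_gt0 => /andP[].
have Pe0 : (0 < P ^ logn P n)%N by rewrite expn_gt0 prime_gt0.
rewrite nE natrM powRM ?ler0n //.
apply: (@le_trans _ _ ((size (divisors m))%:R * (logn P n).+1%:R)).
  rewrite -natrM ler_nat (leq_trans (size_divisorsM _ _)) //.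
  by rewrite leq_mul2l size_divisorsX ?orbT.
have IHm : (size (divisors m))%:R <= C ^+ minn P P0 * m%:R `^ eps.
  apply: IH => // p pp pm.
  have := smooth p pp; rewrite nE dvdn_mulr // => /(_ isT).
  rewrite ltnS leq_eqVlt.
  case/predU1P => // pE; move: Pm; rewrite -pE prime_coprime // pm //.
apply: le_trans (ler_pM _ _ IHm (bound P (logn P n) pP)) _; rewrite ?ler0n //.
rewrite mulrACA ler_wpM2r ?mulr_ge0 ?powR_ge0 //.
case: ifP => PP0; last by rewrite mulr1 CP.
by rewrite (minn_idPl PP0) (minn_idPl (ltnW PP0)) exprSr.
Qed.

End DivisorBound.

(** * Asymptotics *)

Section Bounds.
Variable R : realType.

(** Each term is at most [M ^ 2 / d], which leaves a harmonic sum. *)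
Lemma sum_divn_sqr_le M : (0 < M)%N ->
  (\sum_(1 <= d < M.+1) d * (M %/ d) ^ 2)%:R <=
    M%:R ^+ 2 * (1 + ln M%:R) :> R.
Proof.
move=> M0; apply: le_trans (ler_wpM2l (sqr_ge0 _) (harmonic_le_ln R M0)).
rewrite natr_sum mulr_sumr; apply: ler_sum_nat => d /andP[d0 _].
have d0' : 0 < d%:R :> R by rewrite ltr0n.
rewrite ler_pdivlMr // mulrC -natrX -natrM ler_nat.
by rewrite mulnA mulnn -expnMn leq_sqr mulnC leq_divM.
Qed.

(** Only [b <= K / 6] is kept, where each floor is at least [K / (12 * b)]. The square gives 144,
    and [harmonic_le_totient] doubles it to 288. *)
Lemma sum_totient_divn_sqr_ge K :
  K%:R ^+ 2 / 288 * ln (K %/ 6).+1%:R <=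
    (\sum_(1 <= b < K.+1) totient b * (K %/ (6 * b)) ^ 2)%:R :> R.
Proof.
set L := (K %/ 6)%N.
have LK : (L.+1 <= K.+1)%N by rewrite ltnS leq_div.
apply: (@le_trans _ _ (K%:R ^+ 2 / 144 *
    \sum_(1 <= b < L.+1) (totient b)%:R / b%:R ^+ 2)).
  rewrite (_ : K%:R ^+ 2 / 144 = K%:R ^+ 2 / 288 * 2); last by field.
  rewrite -[leRHS]mulrA ler_wpM2l ?divr_ge0 ?sqr_ge0 ?ler0n //.
  exact: le_trans (ln_le_harmonic R L) (harmonic_le_totient R L).
rewrite natr_sum mulr_sumr (@big_cat_nat _ _ _ L.+1 1 K.+1) //=.
apply: ler_wpDr; first by rewrite sumr_ge0.
apply: ler_sum_nat => b /andP[b0]; rewrite ltnS => bL.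
have b0' : b%:R != 0 :> R by rewrite pnatr_eq0 -lt0n.
(* A positive floor [q] satisfies [K < 6 * b * q.+1 <= 12 * b * q]. *)
have q : (K <= 12 * b * (K %/ (6 * b)))%N.
  have b6 : (0 < 6 * b)%N by lia.
  have := ltn_ceil K b6.
  have : (0 < K %/ (6 * b))%N.
    by rewrite divn_gt0 // mulnC -leq_divRL.
  by move: (K %/ (6 * b))%N => q; nia.
rewrite natrM mulrCA ler_wpM2l // natrX.
rewrite (_ : K%:R ^+ 2 / 144 / _ = (K%:R / (12 * b%:R)) ^+ 2); last by field.
rewrite lerXn2r ?nnegrE ?divr_ge0 ?mulr_ge0 //.
rewrite ler_pdivrMr ?mulr_gt0 ?ltr0n // -!natrM ler_nat mulnC //.
Qed.

Lemma nb_square_cubes2_le_NlnN N : (12 <= N)%N ->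
  1 <= ln N%:R :> R ->
  (nb_square_cubes 2 N)%:R <= 36 * (N%:R * ln N%:R) :> R.
Proof.
move=> N12 lnN; have N0 : (0 < N)%N by lia.
set M := Nat.sqrt (12 * N).
have M0 : (0 < M)%N by apply: sqrt_ge; lia.
have MM : (M ^ 2 <= 12 * N)%N := sqrt_le _.
apply: (@le_trans _ _ (M%:R ^+ 2 * (1 + ln M%:R))).
  by apply: le_trans (sum_divn_sqr_le M0); rewrite ler_nat nb_square_cubes2_le.
(* From [M <= M ^ 2 <= 12 * N <= N ^ 2]; with [1 <= ln N] this gives [1 + ln M <= 3 * ln N], hence
   36 as 12 times 3. *)
have lnM : ln M%:R <= 2 * ln N%:R :> R.
  rewrite mulr2n mulrDl !mul1r -lnM ?posrE ?ltr0n //.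
  rewrite -natrM ler_ln ?posrE ?ltr0n ?muln_gt0 ?N0 //.
  rewrite ler_nat (leq_trans (leq_pmulr M M0)) // mulnn (leq_trans MM) //.
  by rewrite leq_mul2r N12 orbT.
have -> : 36 * (N%:R * ln N%:R) = (12 * N%:R) * (3 * ln N%:R) :> R by ring.
apply: ler_pM; rewrite ?sqr_ge0 ?addr_ge0 ?ln_ge0 ?ler1n //.
  by rewrite -natrX -natrM ler_nat.
lra.
Qed.

Lemma nb_square_cubes2_ge_NlnN N : (900 <= N)%N ->
  (288 * 16)^-1 * (N%:R * ln N%:R) <= (nb_square_cubes 2 N)%:R :> R.
Proof.
move=> N900; set K := Nat.sqrt N.
have K30 : (30 <= K)%N by apply: sqrt_ge.
have NK : (N < K.+1 ^ 2)%N := sqrt_lt N.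
apply: (@le_trans _ _ (K%:R ^+ 2 / 288 * ln (K %/ 6).+1%:R)); last first.
  apply: le_trans (sum_totient_divn_sqr_ge K) _.
  by rewrite ler_nat sum_totient_le_nb_square_cubes2.
have L6 : (6 <= (K %/ 6).+1)%N by rewrite ltnS leq_divRL.
(* The threshold 900 gives [K >= 30], so [L = (K %/ 6).+1] is at least 6 and
   [K.+1 <= 6 * L <= L ^ 2]. The factor 16 is 4 from this logarithm times 4 from
   [N <= 4 * K ^ 2]. *)
have NL : (N <= (K %/ 6).+1 ^ 4)%N.
  have KL : (K.+1 <= 6 * (K %/ 6).+1)%N by rewrite mulnC ltn_ceil.
  rewrite (leq_trans (ltnW NK)) // (expnM _ 2 2) leq_sqr (leq_trans KL) //.
  by rewrite -mulnn leq_mul2r L6 orbT.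
move: (K %/ 6).+1 L6 NL => L L6 NL.
have lnL : ln N%:R <= 4 * ln L%:R :> R.
  rewrite mulr_natl -lnXn ?ltr0n //; last by lia.
  by rewrite -natrX ler_ln ?posrE ?ltr0n ?expn_gt0 ?ler_nat //; lia.
have N4 : N%:R <= 4 * K%:R ^+ 2 :> R.
  rewrite -natrX -natrM ler_nat; move: NK; rewrite -!mulnn; nia.
have ln0 : 0 <= ln N%:R :> R by rewrite ln_ge0 // ler1n; lia.
have := ler_pM (ler0n _ _) ln0 N4 lnL.
rewrite ler_pdivrMl ?mulr_gt0 ?ltr0n // => /le_trans; apply.
by rewrite le_eqVlt; apply/orP; left; apply/eqP; field.
Qed.

Lemma nb_square_cubes_le_powR d (eps : R) : (0 < d)%N -> 0 < eps ->
  exists C : R, forall N : nat, (0 < N)%N ->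
    (nb_square_cubes d N)%:R <= C * N%:R `^ (1 + eps).
Proof.
move=> d0 eps0; have d0' : 0 < d%:R :> R by rewrite ltr0n.
(* The exponent [eps / d] compensates the power [d] to which the divisor bound is raised. *)
have [C divC] := divisor_bound (divr_gt0 eps0 d0').
have C1 : 1 <= C.
  have := divC 1%N isT; rewrite powR1 mulr1; apply: le_trans.
  by rewrite ler1n.
have C0 := le_trans ler01 C1.
exists (8 * (C + 1) ^+ d) => N N0.
set P := N%:R `^ (eps / d%:R).
(* This absorbs the successor after truncation: [C * P + 1 <= (C + 1) * P]. *)
have P1 : 1 <= P.
  by rewrite -[1](@powRr0 R N%:R) ler_powR ?ler1n ?divr_ge0 // ltW.
have -> : N%:R `^ (1 + eps) = N%:R * P ^+ d :> R.
  rewrite powRD ?pnatr_eq0 -?lt0n ?N0 ?implybT // powRr1 ?ler0n //.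
  by rewrite -powR_mulrn ?powR_ge0 // -powRrM divfK // gt_eqF.
have CP0 : 0 <= C * P by rewrite mulr_ge0 ?powR_ge0.
apply: le_trans (_ : (8 * N * (Num.truncn (C * P)).+1 ^ d)%:R <= _).
  rewrite ler_nat nb_square_cubes_le // => n /andP[n0 nN].
  rewrite truncn_ge_nat // (le_trans (divC n n0)) // ler_wpM2l //.
  by rewrite ge0_ler_powR ?nnegrE ?ler_nat ?divr_ge0 // ltW.
rewrite natrM natrX natrM -!mulrA ler_wpM2l // mulrCA ler_wpM2l ?ler0n //.
rewrite -exprMn lerXn2r ?nnegrE ?mulr_ge0 ?addr_ge0 ?powR_ge0 //.
by rewrite -natr1 mulrDl mul1r lerD ?truncn_le.
Qed.

End Bounds.

Theorem theorem1p7 (R : realType) :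
  (exists c1 c2 : R, [/\ 0 < c1, 0 < c2 &
     \forall N \near \oo,
       c1 * (N%:R * ln N%:R) <= (nb_square_cubes 2 N)%:R
         <= c2 * (N%:R * ln N%:R)]) /\
  (forall d : nat, (1 <= d)%N -> forall eps : R, 0 < eps ->
     exists C : R, forall N : nat, (1 <= N)%N ->
       (nb_square_cubes d N)%:R <= C * N%:R `^ (1 + eps)).
Proof.
split=> [|d d0 eps eps0]; last exact: nb_square_cubes_le_powR.
exists (288 * 16)^-1, 36; split; rewrite ?invr_gt0 ?mulr_gt0 ?ltr0n //.
near=> N.
have N900 : (900 <= N)%N by near: N; exact: nbhs_infty_ge.
have lnN : 1 <= ln N%:R :> R.
  rewrite -ler_expR lnK ?posrE ?ltr0n; last by lia.
  by near: N; exact: nbhs_infty_ger.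
rewrite nb_square_cubes2_ge_NlnN //=.
by apply: nb_square_cubes2_le_NlnN => //; lia.
Unshelve. all: by end_near.
Qed.
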